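(* Let $D\subset\mathbb R^m$ be a convex set, and let $\mathcal T:D\to\mathbb R^{n^{\times d}}_{ps,+}$ be logconvex. Then the function $D\to\mathbb R_+$, $x\mapsto\rho(\mathcal T(x))$, is logconvex.
   Context: Let $m,n\ge1$, $d\ge3$ be integers, $[n]=\{1,\dots,n\}$. $\mathbb R^{n^{\times d}}_{ps,+}$ is the set of tensors $\mathcal S=[s_{i_1,\dots,i_d}]$, $i_1,\dots,i_d\in[n]$, with nonnegative real entries symmetric in the last $d-1$ indices. For $z\in\mathbb C^n$, $\mathcal S(z)_i=\sum_{i_2,\dots,i_d\in[n]}s_{i,i_2,\dots,i_d}z_{i_2}\cdots z_{i_d}$ (for a single tensor $\mathcal S$), and $z^{\circ p}=(z_1^p,\dots,z_n^p)^\top$. An eigenvalue of $\mathcal S$ is $\lambda\in\mathbb C$ with $\mathcal S(z)=\lambda z^{\circ(d-1)}$ for some nonzero $z\in\mathbb C^n$; $\rho(\mathcal S)$ is the maximum modulus of the eigenvalues. A function $f:D\to\mathbb R_+=[0,\infty)$ on a convex set $D$ is logconvex if $\log f:D\to[-\infty,\infty)$ is continuous and convex (with $\log0=-\infty$; such an $f$ that vanishes at one point vanishes identically). A tensor-valued function $\mathcal T:D\to\mathbb R^{n^{\times d}}_{ps,+}$ is logconvex if each entry $t_{i_1,\dots,i_d}:D\to\mathbb R_+$ is logconvex. *)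

(* Defs.v *)
From HB Require Import structures.
From mathcomp Require Import all_boot all_order all_algebra all_fingroup.
From mathcomp Require Import complex.
From mathcomp Require Import all_classical all_reals all_analysis.

Set Implicit Arguments.
Unset Strict Implicit.
Unset Printing Implicit Defensive.

Import Order.TTheory GRing.Theory Num.Theory.
Import numFieldNormedType.Exports.

Local Open Scope classical_set_scope.
Local Open Scope ring_scope.

(* The entry s_{i_1,...,i_d} is [S i J], where i = i_1 and
   J = (i_2,...,i_d); the indices are 0-based. *)
Definition tensor (R : Type) (n d : nat) : Type :=
  'I_n -> {ffun 'I_d.-1 -> 'I_n} -> R.

(* Symmetric in the last d - 1 indices. *)
Definition partially_symmetric (R : Type) (n d : nat) (S : tensor R n d) : Prop :=
  forall (i : 'I_n) (J : {ffun 'I_d.-1 -> 'I_n}) (s : 'S_d.-1),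
    S i [ffun k => J (s k)] = S i J.

Definition nonneg_tensor (R : realType) (n d : nat) (S : tensor R n d) : Prop :=
  forall i J, 0 <= S i J.

Definition tensor_apply (R : realType) (n d : nat) (S : tensor R n d)
    (z : 'cV[R[i]]_n) : 'cV[R[i]]_n :=
  \col_i \sum_J real_complex R (S i J) * \prod_k z (J k) 0.

Definition hadamard_pow (C : nzRingType) (n p : nat) (z : 'cV[C]_n) : 'cV[C]_n :=
  \col_i z i 0 ^+ p.

Definition tensor_eigenvalue (R : realType) (n d : nat) (S : tensor R n d)
    (lambda : R[i]) : Prop :=
  exists2 z : 'cV[R[i]]_n,
    z != 0 & tensor_apply S z = lambda *: hadamard_pow d.-1 z.

(* [Normc.normc] is the real-valued modulus on [R[i]]. The supremum is the
   maximum as soon as the latter exists, see [spectral_radius_max]. *)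
Definition spectral_radius (R : realType) (n d : nat) (S : tensor R n d) : R :=
  sup [set Normc.normc lambda | lambda in tensor_eigenvalue S].

Lemma spectral_radius_max (R : realType) (n d : nat) (S : tensor R n d)
    (mu : R[i]) :
  tensor_eigenvalue S mu ->
  (forall lambda, tensor_eigenvalue S lambda ->
     Normc.normc lambda <= Normc.normc mu) ->
  spectral_radius S = Normc.normc mu.
Proof.
move=> Smu mumax; apply/eqP; rewrite eq_le; apply/andP; split.
  by apply: ge_sup => [|_ [l Sl <-]]; [exists (Normc.normc mu), mu|exact: mumax].
apply: ub_le_sup; last by exists mu.
by exists (Normc.normc mu) => _ [l Sl <-]; exact: mumax.
Qed.

(* A function D -> R_+ is represented by a total function, of which only the
   values on D matter; D is meant to be convex. [lne] is the extended
   logarithm, with lne 0 = -oo; in [\bar R], 0 * -oo = 0, so the inequality is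
   trivial for t = 0 and t = 1, and for 0 < t < 1 its right-hand side is -oo
   when f x or f y is 0. *)
Definition logconvex (R : realType) (m : nat) (D : set 'rV[R]_m)
    (f : 'rV[R]_m -> R) : Prop :=
  [/\ forall x, D x -> 0 <= f x,
      {within D, continuous (fun x => lne (f x)%:E)} &
      forall (x y : 'rV[R]_m) (t : R), D x -> D y -> 0 <= t <= 1 ->
        (lne (f (t *: x + (1 - t) *: y)%R)%:E <=
         t%:E * lne (f x)%:E + (1 - t)%:E * lne (f y)%:E)%E].

Definition tensor_logconvex (R : realType) (m n d : nat) (D : set 'rV[R]_m)
    (T : 'rV[R]_m -> tensor R n d) : Prop :=
  forall i J, logconvex D (fun x => T x i J).

(* Main.v *)
Require Import Defs.
From HB Require Import structures.
From mathcomp Require Import all_boot all_order all_algebra all_fingroup.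
From mathcomp Require Import complex.
From mathcomp Require Import all_classical all_reals all_analysis.
From mathcomp Require Import lra.

Set Implicit Arguments.
Unset Strict Implicit.
Unset Printing Implicit Defensive.

Import Order.TTheory GRing.Theory Num.Theory.
Import numFieldNormedType.Exports.

Local Open Scope classical_set_scope.
Local Open Scope ring_scope.

(* For a nonnegative tensor S, [spectral_radius S] is the infimum of the r such
   that S(x) <= r x^(d-1) entrywise for some positive vector x (Collatz-Wielandt).
   Such an r bounds every eigenvalue, and for a positive tensor a minimising pair
   is an eigenpair, since x can be improved to S(x)^(1/(d-1)) unless equality
   holds; the nonnegative case follows by compactness. This description is
   visibly monotone in S and compatible with weighted geometric means, by
   Young's inequality. Logconvexity gives no continuity at the boundary of D, but
   each entry is either identically zero or positive on D, so that nearby tensors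
   are comparable up to a factor close to 1, and hence so are their spectral
   radii. *)

(** * The polynomial map of a tensor on real vectors *)

Definition tensor_form (R : realType) (n d : nat) (S : tensor R n d)
  (x : 'I_n -> R) (i : 'I_n) : R := \sum_J S i J * \prod_k x (J k).

Lemma tensor_form_ge0 (R : realType) (n d : nat) (S : tensor R n d) x i :
  nonneg_tensor S -> (forall j, 0 <= x j) -> 0 <= tensor_form S x i.
Proof.
by move=> S0 x0; apply: sumr_ge0 => J _; rewrite mulr_ge0 ?prodr_ge0.
Qed.

Lemma ler_tensor_form (R : realType) (n d : nat) (S S' : tensor R n d) x y i :
  nonneg_tensor S -> (forall J, S i J <= S' i J) ->
  (forall j, 0 <= x j <= y j) -> tensor_form S x i <= tensor_form S' y i.
Proof.
move=> S0 SS' xy; apply: ler_sum => J _; apply: ler_pM => //.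
  by apply: prodr_ge0 => k _; case/andP: (xy (J k)).
by apply: ler_prod => k _.
Qed.

(** The diagonal monomial [x j ^+ d.-1], at the constant index [J0], already increases strictly;
    [1 < d] keeps its exponent nonzero. *)
Lemma ltr_tensor_form (R : realType) (n d : nat) (S : tensor R n d) x y i j :
  (1 < d)%N -> (forall J, 0 < S i J) ->
  (forall k, 0 <= x k <= y k) -> x j < y j ->
  tensor_form S x i < tensor_form S y i.
Proof.
move=> hd S0 xy xyj; pose J0 : {ffun 'I_d.-1 -> 'I_n} := [ffun=> j].
rewrite /tensor_form (bigD1 J0)//= [ltRHS](bigD1 J0)//=.
apply: ltr_leD.
  rewrite ltr_pM2l//.
  rewrite (eq_bigr (fun=> x j)) => [|k _]; last by rewrite ffunE.
  rewrite [ltRHS](eq_bigr (fun=> y j)) => [|k _]; last by rewrite ffunE.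
  rewrite !prodr_const card_ord ltrXn2r//; first by rewrite -lt0n -ltnS prednK// ltnW.
  by case/andP: (xy j).
apply: ler_sum => J _; rewrite ler_pM2l//.
by apply: ler_prod => k _.
Qed.

Lemma tensor_formZ (R : realType) (n d : nat) (S : tensor R n d) c x i :
  tensor_form S (fun j => c * x j) i = c ^+ d.-1 * tensor_form S x i.
Proof.
rewrite /tensor_form mulr_sumr; apply: eq_bigr => J _.
by rewrite big_split/= prodr_const card_ord mulrCA.
Qed.

(** Multinomial expansion; because of it, adding [t] to all entries of a tensor adds exactly [t] to
    its form on the simplex. *)
Lemma sum_prod_ffun (R : realType) (n p : nat) (x : 'I_n -> R) :
  \sum_(J : {ffun 'I_p -> 'I_n}) \prod_k x (J k) = (\sum_j x j) ^+ p.
Proof.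
by rewrite -(bigA_distr_bigA (fun _ => x)) prodr_const card_ord.
Qed.

(** * Complex moduli and the upper bound on eigenvalues *)

Lemma le_normc_sum (R : realType) (I : finType) (F : I -> R[i]) :
  Normc.normc (\sum_i F i) <= \sum_i Normc.normc (F i).
Proof.
elim/big_rec2 : _ => [|i y1 y2 _ h]; first by rewrite Normc.normc0.
by apply: (le_trans (le_normcD _ _)); rewrite lerD2l.
Qed.

Lemma normc_real (R : realType) (x : R) : 0 <= x ->
  Normc.normc (real_complex R x) = x.
Proof.
by move=> x0; rewrite /Normc.normc/= expr0n addr0 sqrtr_sqr ger0_norm.
Qed.

Lemma normc_prod (R : realType) (I : finType) (F : I -> R[i]) :
  Normc.normc (\prod_i F i) = \prod_i Normc.normc (F i).
Proof.
by apply: (big_morph (@Normc.normc R)) => [x y|];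
  rewrite ?Normc.normcM ?Normc.normc1.
Qed.

Lemma normcX (R : realType) (z : R[i]) p :
  Normc.normc (z ^+ p) = Normc.normc z ^+ p.
Proof.
elim: p => [|p ih]; first by rewrite !expr0 Normc.normc1.
by rewrite !exprS Normc.normcM ih.
Qed.

Lemma normc_ge0 (R : realType) (z : R[i]) : 0 <= Normc.normc z.
Proof. by case: z => a b; rewrite /= sqrtr_ge0. Qed.

(* Collatz-Wielandt: compare [|z|] with the smallest multiple of [x]
   dominating it, at an index where the two agree. *)
Lemma eigenvalue_le (R : realType) (n d : nat) (S : tensor R n d) x r lambda :
  nonneg_tensor S -> (forall i, 0 < x i) ->
  (forall i, tensor_form S x i <= r * x i ^+ d.-1) ->
  tensor_eigenvalue S lambda -> Normc.normc lambda <= r.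
Proof.
move=> S0 x0 Sx [z z0 Sz].
have [i0 zi0] : exists i, z i 0 != 0.
  apply/existsP; apply: contraNT z0; rewrite negb_exists => /forallP zE.
  by apply/eqP/matrixP => i j; rewrite mxE ord1; apply/eqP; rewrite -[_ == _]negbK.
pose y j := Normc.normc (z j 0).
have [i _ imax] := @Order.TotalTheory.arg_maxP _ _ _ i0 predT (fun j => y j / x j) isT.
set c := y i / x i in imax.
have yc j : y j <= c * x j by rewrite -ler_pdivrMr//; exact: imax.
have c0 : 0 < c.
  have := imax i0 isT; apply: lt_le_trans; rewrite divr_gt0// lt_neqAle normc_ge0 andbT.
  by apply: contraNneq zi0 => /esym/Normc.eq0_normc ->.
have yE : y i = c * x i by rewrite /c divfK// gt_eqF.
clearbody c; have yp : 0 < y i ^+ d.-1 by rewrite exprn_gt0// yE mulr_gt0.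
rewrite -(ler_pM2r yp) -normcX -Normc.normcM.
move/matrixP : Sz => /(_ i 0); rewrite !mxE => <-.
apply: (le_trans (le_normc_sum _)).
under eq_bigr do rewrite Normc.normcM normc_real// normc_prod.
rewrite -/(tensor_form S y i).
have /le_trans -> // : tensor_form S y i <= tensor_form S (fun j => c * x j) i.
  by apply: ler_tensor_form => // j; rewrite normc_ge0 yc.
by rewrite tensor_formZ normcX -/(y i) yE exprMn mulrCA ler_wpM2l// exprn_ge0// ltW.
Qed.

Lemma real_eigenvalue (R : realType) (n d : nat) (S : tensor R n d) x r :
  (exists i, x i != 0) -> (forall i, tensor_form S x i = r * x i ^+ d.-1) ->
  tensor_eigenvalue S (real_complex R r).
Proof.
move=> [i xi0] Sx; exists (\col_j real_complex R (x j)).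
  apply: contraNneq xi0 => /matrixP/(_ i 0); rewrite !mxE => /complexI xi0.
  exact/eqP.
apply/matrixP => j k; rewrite !mxE.
rewrite -rmorphXn -rmorphM -Sx /tensor_form rmorph_sum; apply: eq_bigr => J _.
by rewrite rmorphM rmorph_prod; congr (_ * _); apply: eq_bigr => l _; rewrite mxE.
Qed.

(** * Compactness of the simplex *)

Definition simplex (R : realType) (n : nat) : set 'rV[R]_n :=
  [set v | (forall i, 0 <= v 0 i) /\ \sum_i v 0 i = 1].
Arguments simplex : clear implicits.

Lemma continuous_sum_coord (R : realType) (n : nat) :
  continuous (fun v : 'rV[R]_n => \sum_i v 0 i).
Proof.
apply: (@continuous_big R _ +%R) => [|i _]; first exact: add_continuous.
exact: coord_continuous.
Qed.

Lemma continuous_tensor_form (R : realType) (n d : nat) (S : tensor R n d) i :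
  continuous (fun v : 'rV[R]_n => tensor_form S (v 0) i).
Proof.
apply: (@continuous_big R _ +%R) => [|J _ v]; first exact: add_continuous.
apply: (@continuousM R _ (cst (S i J))); first exact: cst_continuous.
have : continuous (fun w : 'rV[R]_n => \prod_k w 0 (J k)).
  apply: (@continuous_big R _ *%R) => [|k _]; first exact: mul_continuous.
  exact: coord_continuous.
by apply.
Qed.

Lemma le1_simplex (R : realType) (n : nat) (v : 'rV[R]_n) i :
  simplex R n v -> v 0 i <= 1.
Proof.
move=> [v0 <-]; rewrite (bigD1 i)//= lerDl.
by apply: sumr_ge0.
Qed.

Lemma compact_simplex (R : realType) (n : nat) : compact (simplex R n).
Proof.
apply: (@subclosed_compact _ _ [set v : 'rV[R]_n | forall i, `[0, 1]%classic (v 0 i)]).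
- have -> : simplex R n =
    (\bigcap_i (fun v : 'rV[R]_n => v 0 i) @^-1` [set t | 0 <= t]) `&`
    (fun v : 'rV[R]_n => \sum_i v 0 i) @^-1` [set 1].
    by apply/seteqP; split => v [v0 v1]; split => // i; [move=> _|]; exact: v0.
  apply: closedI.
    apply: closed_bigI => i _; apply: closed_comp; last exact: closed_ge.
    by move=> v _; exact: coord_continuous.
  apply: closed_comp; last exact: closed_eq.
  by move=> v _; exact: continuous_sum_coord.
- apply: (@rV_compact R n (fun=> `[0, 1]%classic)) => i; exact: segment_compact.
- move=> v vs i /=; rewrite in_itv/= le1_simplex// andbT.
  by case: vs.
Qed.

(** The maximum of 0 and the [g i] is continuous, so it attains its minimum on the compact simplex,
    and that minimum is at most every [e > 0]. *)
Lemma simplex_approx (R : realType) (n : nat) (I : finType)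
    (g : I -> 'rV[R]_n -> R) :
  (forall i, continuous (g i)) ->
  (forall e, 0 < e -> exists2 v, simplex R n v & forall i, g i v <= e) ->
  exists2 v, simplex R n v & forall i, g i v <= 0.
Proof.
move=> gc gP; pose h v := \big[Num.max/0]_i g i v.
have hc : continuous h.
  apply: (@continuous_big R _ Num.max) => // -[x y].
  under eq_fun do rewrite maxr_absE.
  rewrite /continuous_at/=.
  have cx : z.1 @[z --> (x, y)] --> (x : R) by exact: cvg_fst.
  have cy : z.2 @[z --> (x, y)] --> (y : R) by exact: cvg_snd.
  by apply: cvgMl; apply: cvgD; [exact: cvgD|apply: cvg_norm; exact: cvgB].
have s0 : simplex R n !=set0 by have [v vs _] := gP 1 ltr01; exists v.
have [c cs cmin] := EVT_min_rV s0 (@compact_simplex R n) (continuous_subspaceT hc).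
exists c => [|i]; first by rewrite inE in cs.
apply: (@le_trans _ _ (h c)); first exact: le_bigmax.
apply/ler_addgt0Pr => e e0; rewrite add0r.
have [v vs gv] := gP e e0.
apply: (le_trans (cmin v _)); first by rewrite inE.
by apply: bigmax_le => //; exact: ltW.
Qed.

(** * Collatz-Wielandt certificates and the Perron-Frobenius theorem *)

Definition subeigenpair (R : realType) (n d : nat) (S : tensor R n d) x r :=
  (forall i, 0 < x i) /\ forall i, tensor_form S x i <= r * x i ^+ d.-1.

Lemma exists_subeigenpair (R : realType) (n d : nat) (S : tensor R n d) :
  nonneg_tensor S -> exists x r, subeigenpair S x r.
Proof.
move=> S0; exists (fun=> 1), (\sum_i tensor_form S (fun=> 1) i).
split=> // i; rewrite expr1n mulr1 (bigD1 i)//= lerDl.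
by apply: sumr_ge0 => j _; exact: tensor_form_ge0.
Qed.

(** Both sides of the inequality are homogeneous of degree [d.-1], so [x] can be divided by its
    sum. *)
Lemma subeigenpair_simplex (R : realType) (n d : nat) (S : tensor R n d) x r :
  (0 < n)%N -> subeigenpair S x r ->
  exists2 v, simplex R n v & subeigenpair S (v 0) r.
Proof.
move=> n0 [x0 Sx]; pose s := \sum_i x i.
have s0 : 0 < s.
  rewrite /s (bigD1 (Ordinal n0))//= ltr_pwDl//.
  by apply: sumr_ge0 => i _; exact: ltW.
have vE : (\row_j (s^-1 * x j)) 0 = (fun j => s^-1 * x j).
  by apply/funext => j; rewrite mxE.
exists (\row_j (s^-1 * x j)).
  split=> [i|]; first by rewrite mxE mulr_ge0 ?invr_ge0// ltW.
  by under eq_bigr do rewrite mxE; rewrite -mulr_sumr mulVf// gt_eqF.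
rewrite vE; split=> i; first by rewrite mulr_gt0 ?invr_gt0.
by rewrite tensor_formZ exprMn mulrCA ler_pM2l ?exprn_gt0 ?invr_gt0.
Qed.

Lemma tensor_form_gt0 (R : realType) (n d : nat) (S : tensor R n d) v i :
  (1 < d)%N -> (forall i J, 0 < S i J) -> simplex R n v ->
  0 < tensor_form S (v 0) i.
Proof.
move=> hd S0 [v0 v1].
have [j vj] : exists j, 0 < v 0 j.
  apply/existsP; rewrite -[X in is_true X]negbK negb_exists; apply/forallP => vN.
  have /eqP := v1; rewrite big1 ?(eq_sym 0) ?oner_eq0// => j _.
  by apply/eqP; rewrite eq_le v0 leNgt vN.
apply: (@le_lt_trans _ _ (tensor_form S (fun=> 0) i)).
  by apply: tensor_form_ge0 => // k J; exact: ltW.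
apply: (ltr_tensor_form hd _ _ vj) => // k; by rewrite lexx v0.
Qed.

(** Take [y = S(x)^(1/(d-1))] and [c = r^(1/(d-1))]. Then [y <= c * x], strictly at [j], and since
    all entries of [S] are positive, [S(y) < S(c * x) = r * S(x) = r * y^(d-1)] in every
    coordinate. *)
Lemma subeigenpair_improve (R : realType) (n d : nat) (S : tensor R n d) x r j :
  (1 < d)%N -> (forall i J, 0 < S i J) -> subeigenpair S x r ->
  tensor_form S x j < r * x j ^+ d.-1 ->
  exists y r', r' < r /\ subeigenpair S y r'.
Proof.
move=> hd S0 [x0 Sx] Sxj.
have p0 : (0 < d.-1)%N by rewrite -ltnS prednK// ltnW.
have Sn : nonneg_tensor S by move=> i J; exact: ltW.
have Sx0 i : 0 < tensor_form S x i.
  apply: (@le_lt_trans _ _ (tensor_form S (fun=> 0) i)).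
    exact: tensor_form_ge0.
  by apply: (@ltr_tensor_form _ _ _ _ _ _ _ j) => // => k; rewrite lexx ltW.
pose y i := tensor_form S x i `^ (d.-1%:R^-1).
have pR : d.-1%:R != 0 :> R by rewrite pnatr_eq0 -lt0n.
have yX i : y i ^+ d.-1 = tensor_form S x i.
  by rewrite -powR_mulrn ?powR_ge0// -powRrM mulVf// powRr1// ltW.
have y0 i : 0 < y i by rewrite powR_gt0.
have r0 : 0 < r.
  by rewrite -(pmulr_lgt0 _ (exprn_gt0 d.-1 (x0 j))) (lt_le_trans (Sx0 j)).
pose c := r `^ (d.-1%:R^-1).
have c0 : 0 < c by rewrite powR_gt0.
have cX : c ^+ d.-1 = r.
  by rewrite -powR_mulrn ?powR_ge0// -powRrM mulVf// powRr1// ltW.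
have cx0 i : 0 < c * x i by rewrite mulr_gt0.
have yc i : y i <= c * x i.
  by rewrite -(ler_pXn2r p0) ?nnegrE ?(ltW (y0 _)) ?(ltW (cx0 _))// exprMn yX cX.
have ycj : y j < c * x j.
  by rewrite -(ltr_pXn2r p0) ?nnegrE ?(ltW (y0 _)) ?(ltW (cx0 _))// exprMn yX cX.
have Sy i : tensor_form S y i < r * y i ^+ d.-1.
  rewrite yX -cX -tensor_formZ; apply: (ltr_tensor_form hd _ _ ycj) => // k.
  by rewrite yc ltW// y0.
(* Over finitely many coordinates the largest quotient is still below [r]; the default value 0 is
   harmless because [r > 0]. *)
exists y, (\big[Num.max/0]_i (tensor_form S y i / y i ^+ d.-1)); split.
  by apply: bigmax_lt => // i _; rewrite ltr_pdivrMr// exprn_gt0.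
split=> // i; rewrite -ler_pdivrMr ?exprn_gt0//.
exact: (le_bigmax _ (fun i => tensor_form S y i / y i ^+ d.-1)).
Qed.

Lemma continuous_coordX (R : realType) (n p : nat) (c : R) i :
  continuous (fun v : 'rV[R]_n => c * v 0 i ^+ p).
Proof.
move=> v; apply: (@continuousM R 'rV[R]_n (cst c) (fun w => w 0 i ^+ p)); first exact: cst_continuous.
apply: (@continuous_comp _ _ _ (fun w : 'rV[R]_n => w 0 i) (fun t => t ^+ p)).
  exact: coord_continuous.
exact: exprn_continuous.
Qed.

Lemma le1_simplexX (R : realType) (n p : nat) (v : 'rV[R]_n) i :
  simplex R n v -> 0 <= v 0 i ^+ p <= 1.
Proof.
move=> vs; have [v0 _] := vs.
by rewrite exprn_ge0//= exprn_ile1// le1_simplex.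
Qed.

(** The infimum of the certified bounds is attained on the compact simplex. The minimiser has no
    zero coordinate, since [S(v) > 0] there would have to be at most 0, and a strict inequality
    could be improved. *)
Lemma positive_perron (R : realType) (n d : nat) (S : tensor R n d) :
  (0 < n)%N -> (1 < d)%N -> (forall i J, 0 < S i J) ->
  exists v r, [/\ simplex R n v, forall i, 0 < v 0 i &
    forall i, tensor_form S (v 0) i = r * v 0 i ^+ d.-1].
Proof.
move=> n0 hd S0; have Sn : nonneg_tensor S by move=> i J; exact: ltW.
pose E := [set r | exists x, subeigenpair S x r].
have E0 : E !=set0 by have [x [r xr]] := exists_subeigenpair Sn; exists r, x.
have Elb : lbound E 0.
  move=> r [x [x0 Sx]]; have := x0 (Ordinal n0).
  move=> /(exprn_gt0 d.-1)/(pmulr_lge0 r) <-.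
  by apply: le_trans (Sx _); apply: tensor_form_ge0 => // j; exact: ltW.
pose r := inf E.
have [v vs Sv] : exists2 v, simplex R n v &
    forall i, tensor_form S (v 0) i - r * v 0 i ^+ d.-1 <= 0.
  apply: (@simplex_approx _ _ _ (fun i v => tensor_form S (v 0) i - r * v 0 i ^+ d.-1)).
    move=> i v; apply: (@continuousB R R^o 'rV[R]_n (fun w => tensor_form S (w 0) i)
      (fun w => r * w 0 i ^+ d.-1)); first exact: continuous_tensor_form.
    exact: continuous_coordX.
  (* A certificate for some [r' < r + e] misses the bound [r] by at most [e], as powers of simplex
     coordinates are at most 1. *)
  move=> e e0; have [r' [x xr'] r'r] := inf_adherent e0 (conj E0 (ex_intro _ 0 Elb)).
  have [v vs [v0 Sv]] := subeigenpair_simplex n0 xr'; exists v => // i.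
  rewrite lerBlDr (le_trans (Sv i))//.
  have /andP[vp0 vp1] := le1_simplexX d.-1 i vs.
  apply: (@le_trans _ _ ((r + e) * v 0 i ^+ d.-1)); first by rewrite ler_wpM2r// ltW.
  by rewrite mulrDl addrC lerD2r ler_piMr// ltW.
have {}Sv i : tensor_form S (v 0) i <= r * v 0 i ^+ d.-1 by rewrite -subr_le0.
have p0 : d.-1 != 0%N by rewrite -lt0n -ltnS prednK// ltnW.
have v0 i : 0 < v 0 i.
  rewrite lt_neqAle vs.1 andbT; apply/eqP => vi0.
  have := lt_le_trans (tensor_form_gt0 i hd S0 vs) (Sv i).
  by rewrite -vi0 expr0n (negbTE p0) mulr0 ltxx.
exists v, r; split=> // i; apply/eqP; rewrite eq_le Sv leNgt/=.
apply/negP => Svi.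
have [y [r' [r'r yr']]] := subeigenpair_improve hd S0 (conj v0 Sv) Svi.
suff : r <= r' by rewrite leNgt r'r.
by apply: ge_inf; [exists 0|exists y].
Qed.

(* The eigenpairs of the positive tensors [S + t] accumulate, as [t] tends
   to 0, at an eigenpair of [S]. *)
Lemma perron_frobenius (R : realType) (n d : nat) (S : tensor R n d) :
  (0 < n)%N -> (1 < d)%N -> nonneg_tensor S ->
  exists2 lambda, tensor_eigenvalue S lambda &
    forall e, 0 < e -> exists x, subeigenpair S x (Normc.normc lambda + e).
Proof.
move=> n0 hd S0; pose St t : tensor R n d := fun i J => S i J + t.
have StE t v i : simplex R n v ->
    tensor_form (St t) (v 0) i = tensor_form S (v 0) i + t.
  move=> [_ v1]; rewrite /tensor_form.
  under eq_bigr do rewrite mulrDl.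
  by rewrite big_split/= -mulr_sumr sum_prod_ffun v1 expr1n mulr1.
pose P t v r := [/\ simplex R n v, forall i, 0 < v 0 i &
  forall i, tensor_form (St t) (v 0) i = r * v 0 i ^+ d.-1].
have PP t : 0 < t -> exists v r, P t v r.
  by move=> t0; apply: positive_perron => // i J; rewrite ltr_wpDl.
have Stn t : 0 < t -> nonneg_tensor (St t).
  by move=> t0 i J; rewrite addr_ge0// ltW.
have P0 t v r : 0 < t -> P t v r -> 0 <= r.
  move=> t0 [_ v0 Sv]; have := v0 (Ordinal n0).
  move=> /(exprn_gt0 d.-1)/(pmulr_lge0 r) <-; rewrite -Sv.
  by apply: tensor_form_ge0 => [|j]; [exact: Stn|exact: ltW].
(* The eigenvalues for all [t > 0] together: they are monotone in [t], so their infimum is the limit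
   as [t] tends to 0. *)
pose E := [set r | exists t v, 0 < t /\ P t v r].
have E0 : E !=set0 by have [v [r Pr]] := PP 1 ltr01; exists r, 1, v.
have Elb : lbound E 0 by move=> r [t [v [t0 Pr]]]; exact: P0 Pr.
pose r := inf E.
have r0 : 0 <= r by exact: lb_le_inf.
have approx e : 0 < e -> exists t v s, [/\ 0 < t, t < e, P t v s & r <= s < r + e].
  move=> e0; have [s [t [v [t0 Ps]]] sr] := inf_adherent e0 (conj E0 (ex_intro _ 0 Elb)).
  (* Since [u <= t], the vector [v] certifies the bound [s] for [St u], whence [s' <= s < r + e];
     the term [e / 2] gives [u < e]. *)
  pose u := Num.min t (e / 2).
  have u0 : 0 < u by rewrite lt_min t0 divr_gt0.
  have [w [s' Ps']] := PP _ u0.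
  exists u, w, s'; split=> //; first by rewrite gt_min; apply/orP; right; lra.
  rewrite ge_inf/=; [|by exists 0|by exists u, w].
  apply: le_lt_trans sr; rewrite -[s']normc_real; last exact: P0 Ps'.
  case: Ps Ps' => [vs v0 Sv] [ws w0 Sw].
  apply: (@eigenvalue_le _ _ _ (St u) (v 0)) => //; first exact: Stn.
    by move=> i; rewrite -Sv !StE// lerD2l ge_min lexx.
  by apply: real_eigenvalue Sw; exists (Ordinal n0); rewrite gt_eqF.
have [v vs Sv] : exists2 v, simplex R n v &
    forall i, `|tensor_form S (v 0) i - r * v 0 i ^+ d.-1| <= 0.
  apply: (@simplex_approx _ _ _
    (fun i v => `|tensor_form S (v 0) i - r * v 0 i ^+ d.-1|)).
    move=> i v; apply: (@continuous_comp 'rV[R]_n R R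
      (fun w => tensor_form S (w 0) i - r * w 0 i ^+ d.-1) Num.norm);
      last exact: norm_continuous.
    apply: (@continuousB R R^o 'rV[R]_n (fun w => tensor_form S (w 0) i)
      (fun w => r * w 0 i ^+ d.-1)); first exact: continuous_tensor_form.
    exact: continuous_coordX.
  move=> e e0; have [t [v [s [t0 te [vs v0 Sv] /andP[rs sr]]]]] := approx e e0.
  exists v => // i; have /andP[vp0 vp1] := le1_simplexX d.-1 i vs.
  have := Sv i; rewrite StE// => /(canRL (addrK _)) ->.
  (* The quantity is [(s - r) * v 0 i ^+ d.-1 - t], a difference of two numbers in [[0, e]]. *)
  by rewrite ler_norml; apply/andP; split; nra.
exists (real_complex R r).
  apply: (@real_eigenvalue _ _ _ _ (v 0)).
    apply/existsP; apply: contraT; rewrite negb_exists => /forallP vN.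
    case: vs => _ /eqP; rewrite big1 ?(eq_sym 0) ?oner_eq0// => j _.
    by apply/eqP; rewrite -[_ == _]negbK.
  by move=> i; apply/eqP; rewrite -subr_eq0 -normr_le0.
(* A limit eigenvector may have zeros, so the certificate is instead the positive eigenvector of
   some [St t], which dominates [S]. *)
move=> e e0; have [t [w [s [t0 te [ws w0 Sw] /andP[rs sr]]]]] := approx e e0.
exists (w 0); split=> // i; rewrite normc_real//.
apply: (@le_trans _ _ (s * w 0 i ^+ d.-1)).
  by rewrite -Sw StE// lerDl ltW.
by rewrite ler_wpM2r ?exprn_ge0 ?ltW.
Qed.

(** * The spectral radius as the infimum of the certified bounds *)

Section spectral_radius_theory.
Variables (R : realType) (n d : nat).
Hypotheses (n0 : (0 < n)%N) (hd : (1 < d)%N).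
Implicit Types S : tensor R n d.

Lemma spectral_radius_le S x r :
  nonneg_tensor S -> subeigenpair S x r -> spectral_radius S <= r.
Proof.
move=> S0 [x0 Sx]; apply: ge_sup => [|_ [mu Smu <-]].
  by have [mu Smu _] := perron_frobenius n0 hd S0; exists (Normc.normc mu), mu.
exact: eigenvalue_le Smu.
Qed.

(** The inequality is strict because the infimum need not be attained: certificates are positive
    vectors, and a limit of them may have zero coordinates. *)
Lemma spectral_radius_approx S r : nonneg_tensor S -> spectral_radius S < r ->
  exists x, subeigenpair S x r.
Proof.
move=> S0 Sr; have [mu Smu muP] := perron_frobenius n0 hd S0.
suff muS : Normc.normc mu <= spectral_radius S.
  have [|x] := muP (r - Normc.normc mu); first by rewrite subr_gt0 (le_lt_trans muS).
  by rewrite addrC subrK; exists x.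
apply: ub_le_sup; last by exists mu.
have [x [s [x0 Sx]]] := exists_subeigenpair S0.
by exists s => _ [nu Snu <-]; exact: eigenvalue_le Snu.
Qed.

Lemma spectral_radius_ge0 S : nonneg_tensor S -> 0 <= spectral_radius S.
Proof.
move=> S0; have [x [s [x0 Sx]]] := exists_subeigenpair S0.
have [mu Smu _] := perron_frobenius n0 hd S0.
apply: (le_trans (normc_ge0 mu)); apply: ub_le_sup; last by exists mu.
by exists s => _ [nu Snu <-]; exact: eigenvalue_le Snu.
Qed.

(** A certificate for [S'] with bound [r] is one for [S] with bound [c * r]. Used with [c = expR e],
    this yields continuity of the logarithm. *)
Lemma spectral_radius_scale S S' c :
  nonneg_tensor S -> nonneg_tensor S' -> 0 < c ->
  (forall i J, S i J <= c * S' i J) ->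
  spectral_radius S <= c * spectral_radius S'.
Proof.
move=> S0 S'0 c0 SS'; rewrite -ler_pdivrMl//.
apply/ler_addgt0Pr => e e0; rewrite ler_pdivrMl//.
have [x [x0 Sx]] : exists x, subeigenpair S' x (spectral_radius S' + e).
  by apply: spectral_radius_approx => //; rewrite ltrDl.
apply: (@spectral_radius_le _ x) => //; split=> // i.
apply: (@le_trans _ _ (c * tensor_form S' x i)); last by rewrite -mulrA ler_pM2l.
rewrite mulr_sumr; apply: ler_sum => J _.
by rewrite mulrA ler_wpM2r// prodr_ge0// => k _; exact: ltW.
Qed.

End spectral_radius_theory.

(** * Weighted geometric means *)

Definition geomean (R : realType) (t a b : R) := a `^ t * b `^ (1 - t).

Lemma geomean_ge0 (R : realType) (t a b : R) : 0 <= geomean t a b.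
Proof. by rewrite mulr_ge0 ?powR_ge0. Qed.

Lemma geomean_gt0 (R : realType) (t a b : R) :
  0 < a -> 0 < b -> 0 < geomean t a b.
Proof. by move=> a0 b0; rewrite mulr_gt0 ?powR_gt0. Qed.

Lemma geomeanM (R : realType) (t a b a' b' : R) :
  0 <= a -> 0 <= b -> 0 <= a' -> 0 <= b' ->
  geomean t (a * a') (b * b') = geomean t a b * geomean t a' b'.
Proof. by move=> a0 b0 a'0 b'0; rewrite /geomean !powRM// mulrACA. Qed.

Lemma geomean_prod (R : realType) (I : finType) (t : R) (F G : I -> R) :
  (forall i, 0 <= F i) -> (forall i, 0 <= G i) ->
  geomean t (\prod_i F i) (\prod_i G i) = \prod_i geomean t (F i) (G i).
Proof.
move=> F0 G0.
suff [] : [/\ 0 <= \prod_i F i, 0 <= \prod_i G i &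
  geomean t (\prod_i F i) (\prod_i G i) = \prod_i geomean t (F i) (G i)] by [].
elim/big_rec3 : _ => [|i x y z _ [y0 z0 <-]]; first by rewrite /geomean !powR1 mulr1.
by rewrite !mulr_ge0// geomeanM.
Qed.

Lemma geomeanX (R : realType) (t a b : R) p : 0 <= a -> 0 <= b ->
  geomean t (a ^+ p) (b ^+ p) = geomean t a b ^+ p.
Proof.
move=> a0 b0; rewrite -[p]card_ord -!prodr_const.
exact: (@geomean_prod _ 'I_p t (fun=> a) (fun=> b)).
Qed.

(** Young's inequality for [a^t] and [b^(1-t)] with the conjugate exponents [1/t] and [1/(1-t)]. *)
Lemma geomean_young (R : realType) (t a b : R) :
  0 < t < 1 -> 0 <= a -> 0 <= b -> geomean t a b <= t * a + (1 - t) * b.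
Proof.
move=> /andP[t0 t1] a0 b0; have t10 : 0 < 1 - t by rewrite subr_gt0.
have := @conjugate_powR R (a `^ t) (b `^ (1 - t)) t^-1 (1 - t)^-1
  (powR_ge0 _ _) (powR_ge0 _ _).
rewrite !invrK !invr_gt0 -!powRrM !divff ?gt_eqF// !powRr1//.
by rewrite [a * _]mulrC [b * _]mulrC; apply=> //; rewrite addrC subrK.
Qed.

(** For [k > 0], raising to the power [t^-1] reduces the claim to [(c / k)^(1/t) <= alpha + e] for
    all [e > 0]; this covers [alpha = 0] as well. *)
Lemma ler_powRM_limit (R : realType) (t k alpha c : R) :
  0 < t -> 0 <= k -> 0 <= alpha -> 0 <= c ->
  (forall a, alpha < a -> c <= a `^ t * k) -> c <= alpha `^ t * k.
Proof.
move=> t0 k0 alpha0 c0 H; move: k0; rewrite le_eqVlt => /predU1P[kE|k0].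
  have := H (alpha + 1); rewrite -kE !mulr0; apply; by rewrite ltrDl.
have ck0 : 0 <= c / k by rewrite divr_ge0// ltW.
rewrite -ler_pdivrMr//.
have {1}-> : c / k = ((c / k) `^ t^-1) `^ t by rewrite -powRrM mulVf ?gt_eqF// powRr1.
apply: ge0_ler_powR; rewrite ?nnegrE ?powR_ge0//; first exact: ltW.
apply/ler_addgt0Pr => e e0.
have -> : alpha + e = ((alpha + e) `^ t) `^ t^-1.
  by rewrite -powRrM divff ?gt_eqF// powRr1// addr_ge0// ltW.
apply: ge0_ler_powR; rewrite ?nnegrE ?powR_ge0 ?invr_ge0//; first exact: ltW.
by rewrite ler_pdivrMr// H// ltrDl.
Qed.

(** Both weights are positive, so if [a] or [b] is 0, both sides say [c <= 0]; otherwise take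
    exponentials. *)
Lemma lne_geomean (R : realType) (t a b c : R) :
  0 < t < 1 -> 0 <= a -> 0 <= b -> 0 <= c ->
  (lne c%:E <= t%:E * lne a%:E + (1 - t)%:E * lne b%:E)%E = (c <= geomean t a b).
Proof.
move=> /andP[t0 t1] + + c0; have t10 : 0 < 1 - t by rewrite subr_gt0.
have cN : (lne c%:E <= -oo)%E = (c <= 0).
  by rewrite /lne; case: ifPn => _; rewrite leeNy_eq.
rewrite le_eqVlt => /predU1P[<- b0|a0].
  rewrite /geomean powR0 ?gt_eqF// mul0r -cN (le0_lneNy (x := 0)) ?lexx//.
  by rewrite gt0_muleNy.
rewrite le_eqVlt => /predU1P[<-|b0].
  rewrite /geomean (powR0 (lt0r_neq0 t10)) mulr0 -cN (le0_lneNy (x := 0)) ?lexx//.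
  by rewrite gt0_muleNy// addeNy.
rewrite (lne_EFin a0) (lne_EFin b0); move: c0; rewrite le_eqVlt => /predU1P[<-|c0].
  by rewrite le0_lneNy ?lexx// leNye geomean_ge0.
rewrite (lne_EFin c0) -!EFinM -EFinD lee_fin -[LHS]ler_expR lnK ?posrE//.
by rewrite expRD /geomean /powR !gt_eqF.
Qed.

(* If [u] and [v] certify the bounds [a] and [b], their weighted geometric
   mean certifies [geomean t a b]. *)
Lemma spectral_radius_geomean (R : realType) (n d : nat)
    (S1 S2 S : tensor R n d) (t : R) :
  (0 < n)%N -> (1 < d)%N -> 0 < t < 1 ->
  nonneg_tensor S1 -> nonneg_tensor S2 -> nonneg_tensor S ->
  (forall i J, S i J <= geomean t (S1 i J) (S2 i J)) ->
  spectral_radius S <= geomean t (spectral_radius S1) (spectral_radius S2).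
Proof.
move=> n0 hd t01 S10 S20 S0 SS; have /andP[t0 t1] := t01.
have r1 := spectral_radius_ge0 n0 hd S10.
have r2 := spectral_radius_ge0 n0 hd S20.
have r0 := spectral_radius_ge0 n0 hd S0.
have t10 : 0 < 1 - t by rewrite subr_gt0.
(* Certificates are available only strictly above each spectral radius; the bound is proved there
   and passed to the limit one factor at a time. *)
suff key a b : spectral_radius S1 < a -> spectral_radius S2 < b ->
    spectral_radius S <= geomean t a b.
  apply: ler_powRM_limit => //; first exact: powR_ge0.
  move=> a /key k; rewrite mulrC; apply: ler_powRM_limit => //; first exact: powR_ge0.
  by move=> b /k; rewrite mulrC.
move=> Sa Sb.
have a0 : 0 < a by exact: le_lt_trans Sa.
have b0 : 0 < b by exact: le_lt_trans Sb.
have [u [u0 Su]] := spectral_radius_approx n0 hd S10 Sa.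
have [v [v0 Sv]] := spectral_radius_approx n0 hd S20 Sb.
apply: (@spectral_radius_le _ _ _ n0 hd _ (fun i => geomean t (u i) (v i))) => //.
split=> [i|i]; first exact: geomean_gt0.
pose A := a * u i ^+ d.-1; pose B := b * v i ^+ d.-1.
have A0 : 0 < A by rewrite mulr_gt0 ?exprn_gt0.
have B0 : 0 < B by rewrite mulr_gt0 ?exprn_gt0.
have -> : geomean t a b * geomean t (u i) (v i) ^+ d.-1 = geomean t A B.
  by rewrite geomeanM ?exprn_ge0 ?ltW// geomeanX ?ltW.
pose X J := S1 i J * \prod_k u (J k); pose Y J := S2 i J * \prod_k v (J k).
have X0 J : 0 <= X J by rewrite mulr_ge0// prodr_ge0// => k _; exact: ltW.
have Y0 J : 0 <= Y J by rewrite mulr_ge0// prodr_ge0// => k _; exact: ltW.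
(* Hölder's inequality by way of Young's: the normalised sums of [X J / A] and [Y J / B] are at most
   1, so the weights add up to at most [t + (1 - t) = 1]. *)
apply: (@le_trans _ _ (\sum_J geomean t A B * (t * (X J / A) + (1 - t) * (Y J / B)))).
  apply: ler_sum => J _; apply: (@le_trans _ _ (geomean t (X J) (Y J))).
    rewrite geomeanM ?prodr_ge0//; [|by move=> k _; exact: ltW..].
    rewrite -geomean_prod; [|by move=> k; exact: ltW..].
    by rewrite ler_wpM2r// geomean_ge0.
  have {1}-> : X J = A * (X J / A) by rewrite mulrCA divff ?mulr1// gt_eqF.
  have {1}-> : Y J = B * (Y J / B) by rewrite mulrCA divff ?mulr1// gt_eqF.
  rewrite geomeanM ?divr_ge0 ?(ltW A0) ?(ltW B0)// ler_wpM2l ?geomean_ge0//.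
  by rewrite geomean_young// divr_ge0// ltW.
rewrite -mulr_sumr ler_piMr ?geomean_ge0// big_split/= -!mulr_sumr -!mulr_suml.
have XA : (\sum_J X J) / A <= 1 by rewrite ler_pdivrMr// mul1r; exact: Su.
have YB : (\sum_J Y J) / B <= 1 by rewrite ler_pdivrMr// mul1r; exact: Sv.
nra.
Qed.

(** * Logconvex functions on a convex set *)

Lemma convex_set_comb (R : realType) (m : nat) (D : set 'rV[R]_m) x y (t : R) :
  @convex_set R 'rV[R]_m D -> D x -> D y -> 0 <= t <= 1 ->
  D (t *: x + (1 - t) *: y).
Proof.
move=> hD Dx Dy /andP[t0 t1].
by have /set_mem := hD x y (Itv01 t0 t1) (mem_set Dx) (mem_set Dy).
Qed.

(** If [f x = 0], convexity makes the logarithm [-oo] on the segment from [x] to [y] except possibly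
    at [y], so a finite value at [y] would contradict continuity there. *)
Lemma logconvex_eq0 (R : realType) (m : nat) (D : set 'rV[R]_m) f x y :
  @convex_set R 'rV[R]_m D -> logconvex D f -> D x -> D y ->
  f x = 0 -> f y = 0.
Proof.
move=> hD [f0 fc fconv] Dx Dy fx0; apply/eqP; apply: contraT => fy0.
have {}fy0 : 0 < f y by rewrite lt_neqAle eq_sym fy0 f0.
have : lne (f z)%:E @[z --> within D (nbhs y)] --> (ln (f y))%:E.
  by rewrite -lne_EFin//; move/subspace_continuousP : fc => /(_ y Dy).
move=> /fine_cvgP[+ _]; rewrite /prop_near1 /within/= => fin.
have cz : t *: x + (1 - t) *: y @[t --> (0 : R)] --> y.
  have {2}-> : y = 0 *: x + (1 - 0) *: y by rewrite scale0r add0r subr0 scale1r.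
  apply: cvgD; first by apply: cvgZr_tmp; exact: cvg_id.
  by apply: cvgZr_tmp; apply: cvgB; [exact: cvg_cst|exact: cvg_id].
have /cvg_at_right_filter cz' := cz.
near (0 : R)^'+ => t.
have t0 : 0 < t by [].
have t1 : t < 1 by near: t; exact: nbhs_right_lt.
have t01 : 0 <= t <= 1 by rewrite !ltW.
have Dz : D (t *: x + (1 - t) *: y) by exact: convex_set_comb.
have : lne (f (t *: x + (1 - t) *: y))%:E \is a fin_num.
  move: Dz; near: t; exact: cz' fin.
have := fconv x y t Dx Dy t01.
rewrite lne_geomean ?f0 ?t0//.
rewrite fx0 /geomean powR0 ?gt_eqF// mul0r => zle.
by rewrite le0_lneNy// lee_fin.
Unshelve. all: by end_near. Qed.

Lemma ler_expRM (R : realType) (a b e : R) : 0 < a -> 0 < b ->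
  (a <= expR e * b) = (ln a <= e + ln b).
Proof. by move=> a0 b0; rewrite -[RHS]ler_expR expRD !lnK. Qed.

(** An entry that is zero at [x0] is zero on all of [D]; a positive one has a finite, continuous
    logarithm at [x0]. The finitely many entries share a neighbourhood. *)
Lemma tensor_logconvex_near (R : realType) (m n d : nat) (D : set 'rV[R]_m)
    (T : 'rV[R]_m -> tensor R n d) x0 e :
  @convex_set R 'rV[R]_m D -> tensor_logconvex D T -> D x0 -> 0 < e ->
  \forall x \near within D (nbhs x0), forall i J,
    T x i J <= expR e * T x0 i J /\ T x0 i J <= expR e * T x i J.
Proof.
move=> hD hT Dx0 e0.
apply: filter_forall => i; apply: filter_forall => J.
have [T0 Tc _] := hT i J.
have [Tz|Tnz] := eqVneq (T x0 i J) 0.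
  near=> x; have Dx : D x by near: x; exact: withinT.
  by rewrite Tz (logconvex_eq0 hD (hT i J) Dx0 Dx Tz) mulr0.
have {}Tnz : 0 < T x0 i J by rewrite lt_neqAle eq_sym Tnz T0.
have : lne (T x i J)%:E @[x --> within D (nbhs x0)] --> (ln (T x0 i J))%:E.
  by rewrite -lne_EFin//; move/subspace_continuousP : Tc => /(_ x0 Dx0).
move=> /fine_cvgP[fin /cvgrPdist_le/(_ e e0) close].
near=> x.
have : lne (T x i J)%:E \is a fin_num by near: x.
have [Tx|Tx _] := leP (T x i J) 0; first by rewrite le0_lneNy.
have : `|ln (T x0 i J) - fine (lne (T x i J)%:E)| <= e by near: x.
rewrite lne_EFin//= ler_distlC => /andP[h1 h2].
by rewrite !ler_expRM//; split; lra.
Unshelve. all: by end_near. Qed.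

Theorem corollary7 (R : realType) (m n d : nat)
    (hm : (1 <= m)%N) (hn : (1 <= n)%N) (hd : (3 <= d)%N)
    (D : set 'rV[R]_m) (hD : @convex_set R 'rV[R]_m D)
    (T : 'rV[R]_m -> tensor R n d)
    (hTps : forall x, D x -> partially_symmetric (T x))
    (hT0 : forall x, D x -> nonneg_tensor (T x))
    (hT : tensor_logconvex D T) :
  logconvex D (fun x => spectral_radius (T x)).
Proof.
have hd1 : (1 < d)%N by exact: ltnW.
have rho0 x : D x -> 0 <= spectral_radius (T x).
  by move=> Dx; apply: spectral_radius_ge0 => //; exact: hT0.
split=> //; last first.
  (* The endpoints [t = 0] and [t = 1] are settled directly by [0 * -oo = 0]; [lne_geomean] covers
     the open interval. *)
  move=> x y t Dx Dy /andP[]; rewrite le_eqVlt => /predU1P[<- _|t0].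
    by rewrite scale0r add0r subr0 scale1r mul0e add0e mul1e.
  rewrite le_eqVlt => /predU1P[->|t1].
    by rewrite scale1r subrr scale0r addr0 mul1e mul0e adde0.
  have t01 : 0 < t < 1 by rewrite t0.
  have Dz : D (t *: x + (1 - t) *: y) by apply: convex_set_comb => //; rewrite !ltW.
  rewrite lne_geomean ?rho0//; apply: spectral_radius_geomean => //; try exact: hT0.
  move=> i J; have [_ _ /(_ x y t Dx Dy)] := hT i J.
  by rewrite lne_geomean ?hT0// => -> //; rewrite !ltW.
apply/subspace_continuousP => x0 Dx0.
suff : lne (spectral_radius (T x))%:E @[x --> within D (nbhs x0)] -->
  lne (spectral_radius (T x0))%:E by [].
have near_rho e : 0 < e -> \forall x \near within D (nbhs x0),
    spectral_radius (T x) <= expR e * spectral_radius (T x0) /\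
    spectral_radius (T x0) <= expR e * spectral_radius (T x).
  move=> e0; near=> x; have Dx : D x by near: x; exact: withinT.
  have Tx : forall i J, T x i J <= expR e * T x0 i J /\ T x0 i J <= expR e * T x i J.
    by near: x; exact: tensor_logconvex_near.
  by split; apply: spectral_radius_scale => //;
    rewrite ?expR_gt0//; try exact: hT0; move=> i J; case: (Tx i J).
(* If the radius vanishes at [x0], the comparison makes it vanish nearby in [D], so the logarithm is
   constantly [-oo] there; otherwise it is positive nearby and the logarithms differ by at most
   [e]. *)
have [r0|rn0] := eqVneq (spectral_radius (T x0)) 0.
  rewrite r0 le0_lneNy//; apply: cvg_near_cst; near=> x.
  rewrite le0_lneNy// lee_fin.
  suff [+ _] : spectral_radius (T x) <= expR 1 * spectral_radius (T x0) /\
    spectral_radius (T x0) <= expR 1 * spectral_radius (T x) by rewrite r0 mulr0.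
  by near: x; exact: near_rho.
have {}rn0 : 0 < spectral_radius (T x0) by rewrite lt_neqAle eq_sym rn0 rho0.
have pos : \forall x \near within D (nbhs x0), 0 < spectral_radius (T x).
  near=> x; have [_] : spectral_radius (T x) <= expR 1 * spectral_radius (T x0) /\
    spectral_radius (T x0) <= expR 1 * spectral_radius (T x).
    by near: x; exact: near_rho.
  by move=> /(lt_le_trans rn0); rewrite pmulr_rgt0// expR_gt0.
rewrite lne_EFin//; apply/fine_cvgP; split.
  by near=> x; rewrite lne_EFin//; near: x.
apply/cvgrPdist_le => e e0; near=> x.
have rx : 0 < spectral_radius (T x) by near: x.
have [] : spectral_radius (T x) <= expR e * spectral_radius (T x0) /\
    spectral_radius (T x0) <= expR e * spectral_radius (T x).
  by near: x; exact: near_rho.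
rewrite !ler_expRM// => h1 h2.
rewrite [_ x](congr1 fine (lne_EFin rx)) ler_distlC /=.
by apply/andP; split; lra.
Unshelve. all: by end_near. Qed.
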